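(* Let $t \ge 2$, let $\mathscr{L}_1, \ldots, \mathscr{L}_t$ be bounded distributive lattices, and let $\mathscr{L} = \mathscr{L}_1 \times \cdots \times \mathscr{L}_t$ be their product lattice (a decomposable lattice). For each $1 \le i \le t$ let $\mathfrak{q}_i \subseteq \mathscr{L}_i$ be a filter and let $S_i \subseteq \mathscr{L}_i$ be $\vee$-closed. Then $\mathfrak{q} = \mathfrak{q}_1 \times \cdots \times \mathfrak{q}_t$ is an $(S_1 \times \cdots \times S_t)$-filter of $\mathscr{L}$ if and only if $\mathfrak{q}_i$ is an $S_i$-filter of $\mathscr{L}_i$ for any $1 \le i \le t$.
   Context: A bounded lattice has a least element $0$ and a greatest element $1$. The product $\mathscr{L}_1 \times \cdots \times \mathscr{L}_t$ carries the componentwise order, with componentwise joins and meets; it is called a decomposable lattice. A filter of a lattice $\mathscr{L}$ is a non-empty subset $F \subseteq \mathscr{L}$ such that $u \wedge v \in F$ for all $u,v \in F$, and $u \in F$, $w \in \mathscr{L}$, $u \le w$ imply $w \in F$; it is proper if $F \ne \mathscr{L}$. A subset $S \subseteq \mathscr{L}$ is $\vee$-closed if $0 \in S$ and $s_1 \vee s_2 \in S$ for all $s_1,s_2 \in S$. For a $\vee$-closed $S$, a proper filter $\mathfrak{q}$ of $\mathscr{L}$ is called an $S$-filter if for all $u,v \in \mathscr{L}$, $u \vee v \in \mathfrak{q}$ and $u \in S$ imply $v \in \mathfrak{q}$.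
   Formalization: Each filter q_i is assumed proper: if some but not all q_i equal L_i, the product can be an S-filter while such a q_i is not (e.g. L_1 = L_2 = {0,1}, S_i = {0}, q_1 = {1}, q_2 = L_2). *)

(* Defs.v *)
From HB Require Import structures.
From mathcomp Require Import all_boot all_order.
From mathcomp Require Import boolp classical_sets.

Set Implicit Arguments.
Unset Strict Implicit.
Unset Printing Implicit Defensive.

Import Order.Theory.
Local Open Scope classical_set_scope.
Local Open Scope order_scope.

Fact dprod_display : Order.disp_t. Proof. exact: Order.Disp tt tt. Qed.

(* A copy of {dffun forall i, L i}, so that the componentwise order is attached
   to this name only; MathComp itself has products of two lattices and powers
   of one lattice, but no product of a finite family. *)
Definition dprod_lattice (I : finType) (d : I -> Order.disp_t)
  (L : forall i, tbDistrLatticeType (d i)) : Type := {dffun forall i, L i}.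

Section ProductLattice.
Variables (I : finType) (d : I -> Order.disp_t).
Variable L : forall i, tbDistrLatticeType (d i).
Local Notation P := (dprod_lattice L).
Implicit Types x y z : P.

HB.instance Definition _ := Choice.copy P {dffun forall i, L i}.

Definition dprod_le x y := [forall i, x i <= y i].
Definition dprod_meet x y : P := [ffun i => x i `&` y i].
Definition dprod_join x y : P := [ffun i => x i `|` y i].
Definition dprod_bot : P := [ffun i => \bot].
Definition dprod_top : P := [ffun i => \top].

Fact dprod_le_refl : reflexive dprod_le.
Proof. by move=> x; apply/forallP => i. Qed.

Fact dprod_le_anti : antisymmetric dprod_le.
Proof.
move=> x y /andP[/forallP xy /forallP yx]; apply/ffunP => i.
by apply/le_anti; rewrite xy yx.
Qed.

Fact dprod_le_trans : transitive dprod_le.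
Proof.
move=> y x z /forallP xy /forallP yz; apply/forallP => i.
exact: le_trans (xy i) (yz i).
Qed.

HB.instance Definition _ := Order.Le_isPOrder.Build dprod_display P
  dprod_le_refl dprod_le_anti dprod_le_trans.

Fact dprod_meetC : commutative dprod_meet.
Proof. by move=> x y; apply/ffunP => i; rewrite !ffunE meetC. Qed.

Fact dprod_joinC : commutative dprod_join.
Proof. by move=> x y; apply/ffunP => i; rewrite !ffunE joinC. Qed.

Fact dprod_meetA : associative dprod_meet.
Proof. by move=> x y z; apply/ffunP => i; rewrite !ffunE meetA. Qed.

Fact dprod_joinA : associative dprod_join.
Proof. by move=> x y z; apply/ffunP => i; rewrite !ffunE joinA. Qed.

Fact dprod_joinKI y x : dprod_meet x (dprod_join x y) = x.
Proof. by apply/ffunP => i; rewrite !ffunE joinKI. Qed.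

Fact dprod_meetKU y x : dprod_join x (dprod_meet x y) = x.
Proof. by apply/ffunP => i; rewrite !ffunE meetKU. Qed.

Fact dprod_leEmeet x y : (x <= y) = (dprod_meet x y == x).
Proof.
apply/forallP/eqP => [xy|<- i]; last by rewrite !ffunE leIr.
by apply/ffunP => i; rewrite !ffunE; apply/meet_idPl.
Qed.

Fact dprod_meetUl : left_distributive dprod_meet dprod_join.
Proof. by move=> x y z; apply/ffunP => i; rewrite !ffunE meetUl. Qed.

HB.instance Definition _ := Order.POrder_Meet_isDistrLattice.Build
  dprod_display P dprod_meetC dprod_joinC dprod_meetA dprod_joinA
  dprod_joinKI dprod_meetKU dprod_leEmeet dprod_meetUl.

Fact dprod_le0x x : dprod_bot <= x.
Proof. by apply/forallP => i; rewrite ffunE le0x. Qed.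

Fact dprod_lex1 x : x <= dprod_top.
Proof. by apply/forallP => i; rewrite ffunE lex1. Qed.

HB.instance Definition _ := Order.hasBottom.Build dprod_display P dprod_le0x.
HB.instance Definition _ := Order.hasTop.Build dprod_display P dprod_lex1.

Definition dprod_set (A : forall i, set (L i)) : set P :=
  [set x : P | forall i, A i (x i)].

End ProductLattice.

Definition lattice_filter (d : Order.disp_t) (L : latticeType d) (F : set L) :=
  [/\ F !=set0,
      forall u v, F u -> F v -> F (u `&` v) &
      forall u w, F u -> u <= w -> F w].

Definition proper_filter (d : Order.disp_t) (L : latticeType d) (F : set L) :=
  lattice_filter F /\ F <> [set: L].

Definition vee_closed (d : Order.disp_t) (L : bLatticeType d) (S : set L) :=
  S \bot /\ forall s1 s2, S s1 -> S s2 -> S (s1 `|` s2).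

Definition S_filter (d : Order.disp_t) (L : bLatticeType d) (S q : set L) :=
  proper_filter q /\ forall u v, q (u `|` v) -> S u -> q v.

(* Main.v *)
Require Import Defs.
From mathcomp Require Import all_boot all_order.
From mathcomp Require Import boolp classical_sets.

(** Joins in the product are taken coordinatewise, so the S-filter condition
    on each factor gives the one on the product at once.  For the converse, a
    pair [u], [v] of the factor [i] is lifted to the product with two different
    paddings away from [i]: [\bot] for [u], which keeps the lift in the product
    of the [S j] because a join-closed set contains [\bot], and [\top] for [v],
    which makes the join of the two lifts [\top] away from [i], hence a member
    of the product of the filters.  The condition on the product then puts the
    lift of [v] in the product filter, and its coordinate [i] is [v]
    ([dprod_lift_join], [dprod_set_lift]).

    A filter is proper exactly when it misses [\bot] ([proper_filterE]), and
    the [\bot] of the product lies in a product of filters only if it does so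
    in every factor; hence the product filter is proper as soon as there is a
    factor to look at. *)

Import Order.Theory.
Local Open Scope classical_set_scope.
Local Open Scope order_scope.

Lemma lattice_filter_top (d : Order.disp_t) (L : tbDistrLatticeType d)
  (F : set L) : lattice_filter F -> F \top.
Proof. by move=> [[u Fu] _ upF]; apply: upF Fu (lex1 u). Qed.

(** A filter is closed upwards, so [\bot] generates the whole lattice. *)
Lemma proper_filterE (d : Order.disp_t) (L : tbDistrLatticeType d)
  (F : set L) : proper_filter F <-> lattice_filter F /\ ~ F \bot.
Proof.
split=> -[filtF nF]; split=> // F0; apply: nF; last by rewrite F0.
have [_ _ upF] := filtF.
by apply/seteqP; split=> // u _; apply: upF F0 (le0x u).
Qed.

Section Product.
Context {I : finType} {d : I -> Order.disp_t}.
Context {L : forall i, tbDistrLatticeType (d i)}.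
Implicit Types (A q S : forall i, set (L i)).

Definition dprod_lift (f : forall j, L j) (i : I) (x : L i) :
  dprod_lattice L := [ffun j => dfwith f x j].

Lemma dprod_lift_in f i (x : L i) : dprod_lift f i x i = x.
Proof. by rewrite ffunE dfwith_in. Qed.

Lemma dprod_set_lift A f i (x : L i) :
  (forall j, A j (f j)) -> A i x -> dprod_set A (dprod_lift f i x).
Proof. by move=> Af Ax j; rewrite ffunE; case: dfwithP. Qed.

Lemma dprod_lift_join f g i (x y : L i) :
  dprod_lift f i x `|` dprod_lift g i y =
  dprod_lift (fun j => f j `|` g j) i (x `|` y).
Proof.
apply/ffunP=> j; rewrite !ffunE; have [<-|ij] := eqVneq i j.
  by rewrite !dfwith_in.
by rewrite !dfwith_out.
Qed.

Lemma lattice_filter_dprod q :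
  (forall i, lattice_filter (q i)) -> lattice_filter (dprod_set q).
Proof.
move=> filtq; split.
- by exists \top => i; rewrite ffunE; apply: lattice_filter_top.
- move=> u v qu qv i; rewrite ffunE.
  by have [_ meetq _] := filtq i; apply: meetq.
- move=> u w qu /forallP uw i.
  by have [_ _ upq] := filtq i; apply: upq (qu i) (uw i).
Qed.

(** The index [i0] keeps the product from being the one-point lattice, which
    has no proper filter. *)
Lemma proper_filter_dprod (i0 : I) q :
  (forall i, proper_filter (q i)) -> proper_filter (dprod_set q).
Proof.
move=> propq; apply/proper_filterE; split.
  by apply: lattice_filter_dprod => i; case: (propq i).
have /proper_filterE[_ nq0] := propq i0.
by move=> /(_ i0); rewrite ffunE.
Qed.

Lemma S_filter_dprod (i0 : I) S q : (forall i, S_filter (S i) (q i)) ->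
  S_filter (dprod_set S) (dprod_set q).
Proof.
move=> Sq; split; first by apply: (proper_filter_dprod i0) => i; case: (Sq i).
move=> u v quv Su i; have [_ Sqi] := Sq i.
by apply: Sqi (Su i); have := quv i; rewrite ffunE.
Qed.

(** Properness of the factors is assumed because it cannot be recovered from
    that of the product, for which one proper factor is enough. *)
Lemma S_filter_factor S q :
  (forall i, proper_filter (q i)) -> (forall i, S i \bot) ->
  S_filter (dprod_set S) (dprod_set q) -> forall i, S_filter (S i) (q i).
Proof.
move=> propq S0 [_ Sq] i; split=> // u v quv Su.
(* Padding with [\bot] keeps [u] in the product of the [S j]; padding with
   [\top] keeps the join, and then [v], in the product of the [q j]. *)
rewrite -(dprod_lift_in (fun=> \top) i v).
apply: (Sq (dprod_lift (fun=> \bot) i u)); last exact: dprod_set_lift.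
rewrite dprod_lift_join; apply: dprod_set_lift => // j.
by rewrite joinx1; apply: lattice_filter_top; case: (propq j).
Qed.

End Product.

(* The [q i] are proper filters: an S-filter is proper by definition, and the
   left-to-right implication fails if some but not all of the [q i] are the
   whole lattice. *)
Theorem theorem3p16 (t : nat) (ht : (2 <= t)%N)
    (d : 'I_t -> Order.disp_t) (L : forall i : 'I_t, tbDistrLatticeType (d i))
    (q S : forall i : 'I_t, set (L i))
    (hq : forall i : 'I_t, proper_filter (q i))
    (hS : forall i : 'I_t, vee_closed (S i)) :
  S_filter (dprod_set S) (dprod_set q) <->
  (forall i : 'I_t, S_filter (S i) (q i)).
Proof.
split; first by apply: S_filter_factor => // i; case: (hS i).
exact: (S_filter_dprod (Ordinal (ltnW ht))).
Qed.
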